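(* Let $\lambda$ be a positive integer, let $a,b\in\{0,1,\dots,2\lambda\}$, and call a relation on a $k$-MOFS$(2\lambda)$ square-nontrivial if it is non-trivial on each of the columns $3,\dots,k+2$. Then: (i) there exists a $1$-MOFS$(2\lambda)$ with a square-nontrivial relation satisfying $|X_1|=a$, $|X_2|=b$ if and only if $a=b=\lambda$; (ii) there exists a $2$-MOFS$(2\lambda)$ with a square-nontrivial relation satisfying $|X_1|=a$, $|X_2|=b$ if and only if each of $\lambda,a,b$ is even and ($a=\lambda$ or $b=\lambda$); (iii) there exists a $3$-MOFS$(2\lambda)$ with a square-nontrivial relation satisfying $|X_1|=a$, $|X_2|=b$ if and only if each of $\lambda,a,b$ is even.
   Context: Let $N(n)=\{1,\dots,n\}$ and let $n$ be even. A (binary) frequency square of order $n$ is an $n\times n$ array indexed by $N(n)\times N(n)$ with entries in $\{0,1\}$ such that every row and every column contains exactly $n/2$ zeros and $n/2$ ones. Two frequency squares $F,G$ of order $n$ are orthogonal if for each $(a,b)\in\{0,1\}^2$ the number of cells $(r,c)$ with $(F[r,c],G[r,c])=(a,b)$ equals $n^2/4$. A $k$-MOFS$(n)$ is an ordered set $F_1,\dots,F_k$ of pairwise orthogonal frequency squares of order $n$. Relations: form the $n^2\times(k+2)$ array $\mathcal O$ having a row $(i,j,F_1[i,j],\dots,F_k[i,j])$ for each $(i,j)\in N(n)^2$. Let $Y_1=Y_2=N(n)$ and $Y_c=\{0,1\}$ for $3\le c\le k+2$. A relation is a tuple $(X_1,\dots,X_{k+2})$ with $X_c\subseteq Y_c$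 for all $c$ such that every row of $\mathcal O$ has an even number of positions $c$ for which the $c$-th entry of the row lies in $X_c$. A relation is trivial on column $c$ if $X_c=\emptyset$ or $X_c=Y_c$. Two relations $(X_1,\dots,X_{k+2})$, $(X'_1,\dots,X'_{k+2})$ are equivalent if $|X_i|=|X'_i|$ for all $i$. *)

(* Defs.v *)
From mathcomp Require Import all_boot all_algebra.

Set Implicit Arguments.
Unset Strict Implicit.
Unset Printing Implicit Defensive.

(* N(n) is 'I_n, and the symbols 0 and 1 are false and true. *)
Definition freq_square (n : nat) (F : 'M[bool]_n) : Prop :=
  [/\ ~~ odd n,
      forall (r : 'I_n) (s : bool), #|[set c : 'I_n | F r c == s]| = n %/ 2
    & forall (c : 'I_n) (s : bool), #|[set r : 'I_n | F r c == s]| = n %/ 2].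

Definition orthogonal_squares (n : nat) (F G : 'M[bool]_n) : Prop :=
  forall s t : bool,
    #|[set rc : 'I_n * 'I_n | (F rc.1 rc.2, G rc.1 rc.2) == (s, t)]|
      = n ^ 2 %/ 4.

Definition is_MOFS (k n : nat) (F : 'I_k -> 'M[bool]_n) : Prop :=
  (forall i : 'I_k, freq_square (F i)) /\
  (forall i j : 'I_k, i != j -> orthogonal_squares (F i) (F j)).

(* The k + 2 columns of the array O: the first two are inl ord0 and
   inl ord_max, and column c + 3 (for c : 'I_k counted from 0) is inr c. *)
Definition column (k : nat) : finType := ('I_2 + 'I_k)%type.

Definition first_col (k : nat) : column k := inl ord0.
Definition second_col (k : nat) : column k := inl ord_max.
Definition square_col (k : nat) (c : 'I_k) : column k := inr c.

Definition colY (n k : nat) (c : column k) : finType :=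
  match c with inl _ => 'I_n | inr _ => bool end.

Definition array_entry (k n : nat) (F : 'I_k -> 'M[bool]_n)
    (ij : 'I_n * 'I_n) (c : column k) : colY n c :=
  match c return colY n c with
  | inl p => if p == ord0 then ij.1 else ij.2
  | inr m => F m ij.1 ij.2
  end.

Definition col_subsets (n k : nat) : Type :=
  forall c : column k, {set colY n c}.

Definition is_relation (k n : nat) (F : 'I_k -> 'M[bool]_n)
    (X : col_subsets n k) : Prop :=
  forall ij : 'I_n * 'I_n,
    ~~ odd #|[set c : column k | array_entry F ij c \in X c]|.

Definition trivial_on (k n : nat) (X : col_subsets n k) (c : column k) : Prop :=
  X c = set0 \/ X c = setT.

Definition square_nontrivial (k n : nat) (X : col_subsets n k) : Prop :=
  forall c : 'I_k, ~ trivial_on X (square_col c).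

(* Main.v *)
(** A square-nontrivial relation says that F_1 + ... + F_k = e + x_i + y_j
    modulo 2, where x and y are the indicators of X_1 and X_2.  Reading this
    along one row or column gives a = b = k * lambda modulo 2, and a = b =
    lambda when k = 1.  Summing signs over all cells gives
    +-(2 lambda - 2 a)(2 lambda - 2 b) on the right; the left side vanishes for
    k = 2 by orthogonality and is 4 lambda^2 modulo 8 for k = 3, which forces
    lambda to be even.

    Conversely, squares of the form F_m[i,j] = p_m(i) + q_m(j) suffice: they
    are frequency squares when all p_m and q_m are balanced, F_m and F_m' are
    orthogonal when p_m + p_m' or q_m + q_m' is balanced, and the supports of
    the sums of the p_m and of the q_m provide the relation.  Index the rows
    and the columns by pairs (s, t) of a bit s and one of lambda values t: any
    s + f(t) is balanced, while f(t) is balanced only if f is, which for k = 3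
    is where lambda has to be even. *)

Require Import Defs.
From mathcomp Require Import all_boot all_algebra.
From mathcomp Require Import zify.

Set Implicit Arguments.
Unset Strict Implicit.
Unset Printing Implicit Defensive.

Import GRing.Theory.

Local Notation "\xor_ i F" := (\big[addb/false]_i F)
  (at level 41, F at level 41, i at level 0, format "\xor_ i  F").

Section SignSum.
Local Open Scope ring_scope.
Implicit Types S T : finType.

Definition sign_sum T (f : T -> bool) : int := \sum_x (-1) ^+ f x.

Lemma eq_sign_sum T (f g : T -> bool) : f =1 g -> sign_sum f = sign_sum g.
Proof. by move=> fg; apply: eq_bigr => x _; rewrite fg. Qed.

Lemma cardz_sum T (f : T -> bool) : #|f|%:Z = \sum_x (f x)%:Z.
Proof.
rewrite -sum1_card big_mkcond (big_morph Posz PoszD (erefl 0)).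
by apply: eq_bigr => x _; rewrite unfold_in; case: (f x).
Qed.

Lemma cardzT_sum T : #|T|%:Z = \sum_(x : T) 1.
Proof. by rewrite sumr_const natz. Qed.

Lemma sign_sumE T (f : T -> bool) : sign_sum f = #|T|%:Z - 2 * #|f|%:Z.
Proof.
rewrite cardz_sum cardzT_sum mulr_sumr -sumrB.
by apply: eq_bigr => x _; case: (f x).
Qed.

Lemma card_fiber_sign_sum T (f : T -> bool) s :
  2 * #|[set x | f x == s]|%:Z = #|T|%:Z + (-1) ^+ s * sign_sum f.
Proof.
rewrite cardsE cardz_sum cardzT_sum !mulr_sumr -big_split /=.
by apply: eq_bigr => x _; case: (f x) s => [] [].
Qed.

Lemma card_fiber2_sign_sum T (f g : T -> bool) s t :
  4 * #|[set x | (f x, g x) == (s, t)]|%:Z =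
  #|T|%:Z + (-1) ^+ s * sign_sum f + (-1) ^+ t * sign_sum g
  + (-1) ^+ (s (+) t) * sign_sum (fun x => f x (+) g x).
Proof.
rewrite cardsE cardz_sum cardzT_sum !mulr_sumr -!big_split /=.
by apply: eq_bigr => x _; case: (f x) (g x) s t => [] [] [] [].
Qed.

(* This is (1 - F)(1 - G)(1 - H) expanded and summed, where F, G, H are f, g, h
   with values in {1, -1}. *)
Lemma sign_sum_addb3 T (f g h : T -> bool) :
  sign_sum (fun x => f x (+) g x (+) h x) =
  #|T|%:Z - 8 * #|fun x => [&& f x, g x & h x]|%:Z
  - (sign_sum f + sign_sum g + sign_sum h)
  + (sign_sum (fun x => f x (+) g x) + sign_sum (fun x => f x (+) h x)
     + sign_sum (fun x => g x (+) h x)).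
Proof.
rewrite cardz_sum cardzT_sum mulr_sumr -!big_split -!sumrN -!big_split /=.
by apply: eq_bigr => x _; case: (f x) (g x) (h x) => [] [] [].
Qed.

Lemma sign_sum_addbl T b (f : T -> bool) :
  sign_sum (fun x => b (+) f x) = (-1) ^+ b * sign_sum f.
Proof.
by rewrite mulr_sumr; apply: eq_bigr => x _; rewrite signr_addb.
Qed.

Lemma sign_sum_addb_pair S T (f : S -> bool) (g : T -> bool) :
  sign_sum (fun xy : S * T => f xy.1 (+) g xy.2) = sign_sum f * sign_sum g.
Proof.
rewrite /sign_sum big_distrlr pair_bigA /=.
by apply: eq_bigr => xy _; rewrite signr_addb.
Qed.

End SignSum.

Section Balanced.
Implicit Types S T : finType.

Definition balanced T (f : T -> bool) : bool := 2 * #|f| == #|T|.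

Lemma sign_sum_eq0 T (f : T -> bool) : (sign_sum f == 0%R) = balanced f.
Proof. by rewrite sign_sumE /balanced; lia. Qed.

Lemma balanced_sign_sum T (f : T -> bool) : balanced f -> sign_sum f = 0%R.
Proof. by rewrite -sign_sum_eq0 => /eqP. Qed.

Lemma eq_balanced T (f g : T -> bool) : f =1 g -> balanced f = balanced g.
Proof. by move=> fg; rewrite /balanced (eq_card fg). Qed.

Lemma balanced_even_card T (f : T -> bool) : balanced f -> ~~ odd #|T|.
Proof. by move/eqP <-; rewrite mul2n odd_double. Qed.

Lemma balanced_addbl T b (f : T -> bool) :
  balanced (fun x => b (+) f x) = balanced f.
Proof. by rewrite -!sign_sum_eq0 sign_sum_addbl mulf_eq0 signr_eq0. Qed.

Lemma balanced_addb_pair S T (f : S -> bool) (g : T -> bool) :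
  balanced (fun xy : S * T => f xy.1 (+) g xy.2) = balanced f || balanced g.
Proof. by rewrite -sign_sum_eq0 sign_sum_addb_pair mulf_eq0 !sign_sum_eq0. Qed.

Lemma balanced_pair S T (f : S -> T -> bool) :
  (forall x, balanced (f x)) -> balanced (fun xy : S * T => f xy.1 xy.2).
Proof.
move=> f_bal; rewrite -sign_sum_eq0 /sign_sum.
rewrite -(pair_bigA _ (fun x y => (-1) ^+ f x y)%R) /= big1 // => x _.
exact: balanced_sign_sum.
Qed.

Lemma card_comp_bij S T (h : S -> T) (f : T -> bool) :
  bijective h -> #|f \o h| = #|f|.
Proof.
move=> h_bij; rewrite -!sum1_card (reindex h) //.
exact: onW_bij.
Qed.

Lemma balanced_comp_bij S T (h : S -> T) (f : T -> bool) :
  bijective h -> balanced (f \o h) = balanced f.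
Proof.
by move=> h_bij; rewrite /balanced card_comp_bij // (bij_eq_card h_bij).
Qed.

Lemma balanced_fibersP T (f : T -> bool) : ~~ odd #|T| ->
  balanced f <-> forall s, #|[set x | f x == s]| = #|T| %/ 2.
Proof.
move=> T_even; have fiberE := card_fiber_sign_sum f.
split=> [/balanced_sign_sum f_sum0 s|half].
  by have := fiberE s; rewrite f_sum0 mulr0; lia.
rewrite -sign_sum_eq0; have := fiberE false.
by rewrite half mul1r; lia.
Qed.

Lemma balanced_addb_fibersP T (f g : T -> bool) :
    4 %| #|T| -> balanced f -> balanced g ->
  balanced (fun x => f x (+) g x) <->
  forall s t, #|[set x | (f x, g x) == (s, t)]| = #|T| %/ 4.
Proof.
move=> T_dvd4 /balanced_sign_sum f_sum0 /balanced_sign_sum g_sum0.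
have := card_fiber2_sign_sum f g; rewrite f_sum0 g_sum0 => fiberE.
split=> [/balanced_sign_sum fg_sum0 s t|quarter].
  by have := fiberE s t; rewrite fg_sum0 !mulr0; lia.
rewrite -sign_sum_eq0; have := fiberE false false.
by rewrite quarter !mulr0 mul1r; lia.
Qed.

End Balanced.

Section OddCard.
Implicit Types I T : finType.

Lemma odd_card_xor T (f : T -> bool) : odd #|f| = \xor_x f x.
Proof.
rewrite -sum1_card big_mkcond /= (big_morph odd oddD (erefl _)).
by apply: eq_bigr => x _; rewrite unfold_in; case: (f x).
Qed.

Lemma xor_const T b : \big[addb/false]_(x : T) b = odd #|T| && b.
Proof.
by rewrite big_const; elim: #|T| => //= n ->; case: b (odd n) => [] [].
Qed.

Lemma odd_card_xor_family I T (f : I -> T -> bool) :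
  odd #|fun x => \xor_i f i x| = \xor_i odd #|f i|.
Proof.
rewrite odd_card_xor exchange_big /=.
by apply: eq_bigr => i _; rewrite odd_card_xor.
Qed.

Lemma odd_card_addbl T b (f : T -> bool) :
  ~~ odd #|T| -> odd #|fun x => b (+) f x| = odd #|f|.
Proof.
move=> /negbTE T_even.
by rewrite !odd_card_xor big_split /= xor_const T_even.
Qed.

End OddCard.

Section Squares.
Variable n : nat.
Implicit Types F G : 'M[bool]_n.

Definition entry F (ij : 'I_n * 'I_n) : bool := F ij.1 ij.2.

Lemma freq_squareP F :
  freq_square F <-> (forall i, balanced (F i)) /\ (forall j, balanced (F^~ j)).
Proof.
have fibersP (f : 'I_n -> bool) : ~~ odd n ->
    balanced f <-> forall s, #|[set x | f x == s]| = n %/ 2.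
  by have := @balanced_fibersP _ f; rewrite card_ord.
split=> [[n_even F_row F_col]|[F_row F_col]].
  by split=> x; apply/(fibersP _ n_even) => s; rewrite ?F_row ?F_col.
have n_even : ~~ odd n.
  have [n0|n_gt0] := posnP n; first by rewrite n0.
  by have := balanced_even_card (F_row (Ordinal n_gt0)); rewrite card_ord.
by split=> // x; apply/(fibersP _ n_even).
Qed.

Lemma freq_square_tr F : freq_square F -> freq_square F^T.
Proof.
move=> /freq_squareP[F_row F_col]; apply/freq_squareP; split=> x.
  by rewrite (eq_balanced (g := F^~ x)) // => y; rewrite mxE.
by rewrite (eq_balanced (g := F x)) // => y; rewrite mxE.
Qed.

Lemma freq_square_balanced F : freq_square F -> balanced (entry F).
Proof. by move=> /freq_squareP[F_row _]; exact: balanced_pair. Qed.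

Lemma orthogonal_squaresP F G : freq_square F -> freq_square G ->
  orthogonal_squares F G <-> balanced (fun ij => entry F ij (+) entry G ij).
Proof.
move=> F_freq G_freq; apply: iff_sym; have [n_even _ _] := F_freq.
have cells_card : #|{: 'I_n * 'I_n}| = n ^ 2.
  by rewrite card_prod card_ord mulnn.
have cells_dvd4 : 4 %| #|{: 'I_n * 'I_n}|.
  by rewrite cells_card -mulnn (@dvdn_mul 2 2) // dvdn2.
rewrite /orthogonal_squares -cells_card.
exact: balanced_addb_fibersP (freq_square_balanced _) (freq_square_balanced _).
Qed.

End Squares.

Lemma in_nontrivial_set_bool (A : {set bool}) s :
  A <> set0 -> A <> setT -> (s \in A) = s (+) (false \in A).
Proof.
move=> A_neq0 A_neqT.
case fA: (false \in A); case tA: (true \in A).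
- by case: A_neqT; apply/setP => -[]; rewrite inE ?fA ?tA.
- by case: s; rewrite ?fA ?tA.
- by case: s; rewrite ?fA ?tA.
- by case: A_neq0; apply/setP => -[]; rewrite inE ?fA ?tA.
Qed.

Definition has_nontrivial_relation (k n a b : nat) : Prop :=
  exists (F : 'I_k -> 'M[bool]_n) (X : col_subsets n k),
    is_MOFS F /\
    [/\ is_relation F X, square_nontrivial X,
        #|X (first_col k)| = a & #|X (second_col k)| = b].

Section Relations.
Variables k n : nat.
Implicit Types (F : 'I_k -> 'M[bool]_n) (A B : {set 'I_n}).

Definition xor_splits F (e : bool) A B : Prop :=
  forall i j, \xor_m F m i j = e (+) (i \in A) (+) (j \in B).

Lemma xor_splits_tr F e A B :
  xor_splits F e A B -> xor_splits (fun m => (F m)^T%R) e B A.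
Proof.
move=> split_F i j; rewrite addbAC -split_F.
by apply: eq_bigr => m _; rewrite mxE.
Qed.

Lemma odd_card_array_row F (X : col_subsets n k) i j :
  odd #|[set c : column k | array_entry F (i, j) c \in X c]| =
  (i \in X (first_col k)) (+) (j \in X (second_col k))
  (+) \xor_m (F m i j \in X (square_col m)).
Proof.
rewrite cardsE odd_card_xor big_sumType /= !big_ord_recl big_ord0 addbF /=.
by rewrite (_ : lift ord0 ord0 = ord_max) //; apply: val_inj.
Qed.

Lemma relation_xor_splits F (X : col_subsets n k) :
    is_relation F X -> square_nontrivial X ->
  exists e, xor_splits F e (X (first_col k)) (X (second_col k)).
Proof.
move=> F_rel X_nontriv; exists (\xor_m (false \in X (square_col m))) => i j.
have := F_rel (i, j); rewrite odd_card_array_row.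
under eq_bigr => m _.
  rewrite (in_nontrivial_set_bool (F m i j)); first over.
  - by move=> X_set0; case: (X_nontriv m); left.
  - by move=> X_setT; case: (X_nontriv m); right.
rewrite big_split /=.
by do 2!case: (\xor_m _); case: (_ \in _) (_ \in _) => [] [].
Qed.

Definition relation_of_sets A B : col_subsets n k := fun c =>
  match c return {set colY n c} with
  | inl u => if u == ord0 then A else B
  | inr _ => [set true]
  end.

Lemma relation_of_setsP F A B :
  xor_splits F false A B -> is_relation F (relation_of_sets A B).
Proof.
move=> split_F [i j]; rewrite odd_card_array_row /=.
under eq_bigr do rewrite inE eqb_id.
by rewrite split_F addbb.
Qed.

Lemma relation_of_sets_nontrivial A B :
  square_nontrivial (relation_of_sets A B).
Proof.
by move=> m [] /setP; [move/(_ true)|move/(_ false)]; rewrite !inE.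
Qed.

Lemma has_nontrivial_relation_xor_splits a b :
    has_nontrivial_relation k n a b ->
  exists F e A B, [/\ is_MOFS F, xor_splits F e A B, #|A| = a & #|B| = b].
Proof.
move=> [F [X [F_MOFS [F_rel X_nontriv card_A card_B]]]].
have [e split_F] := relation_xor_splits F_rel X_nontriv.
by exists F, e, (X (first_col k)), (X (second_col k)).
Qed.

Lemma xor_splits_odd_card F e A B : 0 < n -> ~~ odd n ->
    (forall m, freq_square (F m)) -> xor_splits F e A B ->
  odd #|B| = odd (k * n./2).
Proof.
move=> n_gt0 n_even F_freq split_F; pose i := Ordinal n_gt0.
have F_row m : #|F m i| = n./2.
  have /freq_squareP[/(_ i)/eqP + _] := F_freq m.
  by rewrite card_ord mul2n => /(congr1 half); rewrite doubleK.
rewrite -(odd_card_addbl (e (+) (i \in A)) (mem B)) ?card_ord //.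
rewrite -(eq_card (A := fun j => \xor_m F m i j)); last exact: split_F.
rewrite odd_card_xor_family; under eq_bigr do rewrite F_row.
by rewrite xor_const card_ord oddM.
Qed.

End Relations.

Lemma xor_splits1_card n (F : 'I_1 -> 'M[bool]_n) e (A B : {set 'I_n}) :
    0 < n -> freq_square (F ord0) -> xor_splits F e A B ->
  2 * #|B| = n.
Proof.
move=> n_gt0 /freq_squareP[F_row _] split_F; pose i := Ordinal n_gt0.
have: balanced (fun j => e (+) (i \in A) (+) (j \in B)).
  rewrite -(eq_balanced (f := F ord0 i)) // => j.
  by rewrite -split_F big_ord1.
by rewrite balanced_addbl /balanced card_ord => /eqP.
Qed.

Lemma xor_splits2_card n (F : 'I_2 -> 'M[bool]_n) e (A B : {set 'I_n}) :
  is_MOFS F -> xor_splits F e A B -> 2 * #|A| = n \/ 2 * #|B| = n.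
Proof.
move=> [F_freq F_orth] split_F.
have /(orthogonal_squaresP (F_freq _) (F_freq _)) :=
  F_orth ord0 (lift ord0 ord0) isT.
rewrite (eq_balanced (g := fun ij => e (+) (ij.1 \in A) (+) (ij.2 \in B))).
  rewrite (balanced_addb_pair (fun i => e (+) (i \in A)) (mem B)).
  rewrite balanced_addbl /balanced card_ord.
  by case/orP=> /eqP; [left | right].
by move=> ij; rewrite -split_F big_ord_recl big_ord1.
Qed.

Lemma MOFS3_sign_sum n (F : 'I_3 -> 'M[bool]_n) : is_MOFS F ->
  exists t : nat,
    sign_sum (fun ij => \xor_m entry (F m) ij) = ((n ^ 2)%N%:Z - 8 * t%:Z)%R.
Proof.
move=> [F_freq F_orth].
pose m1 : 'I_3 := lift ord0 ord0; pose m2 : 'I_3 := lift ord0 (lift ord0 ord0).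
have entry_sum0 m : sign_sum (entry (F m)) = 0%R.
  exact/balanced_sign_sum/freq_square_balanced.
have pair_sum0 m m' : m != m' ->
    sign_sum (fun ij => entry (F m) ij (+) entry (F m') ij) = 0%R.
  move=> /F_orth/(orthogonal_squaresP (F_freq _) (F_freq _)).
  exact: balanced_sign_sum.
exists #|fun ij => [&& entry (F ord0) ij, entry (F m1) ij & entry (F m2) ij]|.
have := sign_sum_addb3 (entry (F ord0)) (entry (F m1)) (entry (F m2)).
rewrite !entry_sum0 !pair_sum0 // card_prod card_ord mulnn.
rewrite !(addr0, subr0) => <-.
by apply: eq_sign_sum => ij; rewrite !big_ord_recl big_ord0 addbF addbA.
Qed.

Lemma xor_splits_sign_sum n k (F : 'I_k -> 'M[bool]_n) e (A B : {set 'I_n}) :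
    xor_splits F e A B ->
  sign_sum (fun ij => \xor_m entry (F m) ij) =
  ((-1) ^+ e * (n%:Z - 2 * #|A|%:Z) * (n%:Z - 2 * #|B|%:Z))%R.
Proof.
move=> split_F.
rewrite (eq_sign_sum (g := fun ij => e (+) (ij.1 \in A) (+) (ij.2 \in B))).
  rewrite (sign_sum_addb_pair (fun i => e (+) (i \in A)) (mem B)).
  by rewrite sign_sum_addbl !sign_sumE card_ord.
by move=> ij; exact: split_F.
Qed.

Lemma xor_splits3_even l (F : 'I_3 -> 'M[bool]_(2 * l)) e A B :
    is_MOFS F -> xor_splits F e A B -> odd #|A| = odd l -> odd #|B| = odd l ->
  ~~ odd l.
Proof.
move=> F_MOFS split_F; have [t] := MOFS3_sign_sum F_MOFS.
rewrite (xor_splits_sign_sum split_F) expnMn !PoszM.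
move: #|A| #|B| => a b cells odd_a odd_b.
have [u uE] : exists u : int, ((2 * l)%N%:Z - 2 * a%:Z = 4 * u)%R.
  by exists ((l%:Z - a%:Z)%R %/ 2)%Z; lia.
have [v vE] : exists v : int, ((2 * l)%N%:Z - 2 * b%:Z = 4 * v)%R.
  by exists ((l%:Z - b%:Z)%R %/ 2)%Z; lia.
suff: ~~ odd (l ^ 2) by rewrite oddX.
have : ((l ^ 2)%N%:Z = 2 * (t%:Z + 2 * ((-1) ^+ e * (u * v))))%R.
  by move: cells; rewrite uE vE; case: e {split_F}; rewrite ?expr0 ?expr1; lia.
by move: (_ + _)%R => w; lia.
Qed.

Section ProductSquares.
Variables (k n : nat) (p q : 'I_k -> 'I_n -> bool).

Definition product_squares (m : 'I_k) : 'M[bool]_n :=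
  \matrix_(i, j) (p m i (+) q m j).

Hypothesis p_balanced : forall m, balanced (p m).
Hypothesis q_balanced : forall m, balanced (q m).
Hypothesis pq_balanced : forall m m' : 'I_k, m < m' ->
  balanced (fun i => p m i (+) p m' i) || balanced (fun j => q m j (+) q m' j).

Lemma product_squares_freq m : freq_square (product_squares m).
Proof.
apply/freq_squareP; split=> z.
  rewrite (eq_balanced (g := fun j => p m z (+) q m j)) ?balanced_addbl //.
  by move=> j; rewrite mxE.
rewrite (eq_balanced (g := fun i => q m z (+) p m i)) ?balanced_addbl //.
by move=> i; rewrite mxE addbC.
Qed.

Lemma product_squares_MOFS : is_MOFS product_squares.
Proof.
pose orthogonal m m' := balanced (fun ij =>
  entry (product_squares m) ij (+) entry (product_squares m') ij).
have orthogonalC m m' : orthogonal m m' = orthogonal m' m.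
  by apply: eq_balanced => ij; rewrite addbC.
have orthogonal_lt (m m' : 'I_k) : m < m' -> orthogonal m m'.
  move=> /pq_balanced; rewrite -balanced_addb_pair; congr is_true.
  by apply: eq_balanced => ij; rewrite /entry !mxE addbACA.
split=> [|m m']; first exact: product_squares_freq.
rewrite neq_ltn => m_m'.
apply/(orthogonal_squaresP (product_squares_freq m) (product_squares_freq m')).
case/orP: m_m' => /orthogonal_lt //.
by rewrite orthogonalC.
Qed.

Lemma product_squares_relation :
  has_nontrivial_relation k n #|fun i => \xor_m p m i| #|fun j => \xor_m q m j|.
Proof.
pose A := [set i | \xor_m p m i]; pose B := [set j | \xor_m q m j].
exists product_squares, (relation_of_sets A B).
split; first exact: product_squares_MOFS.
split; rewrite ?cardsE //; last exact: relation_of_sets_nontrivial.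
apply: relation_of_setsP => i j; rewrite !inE -big_split.
by apply: eq_bigr => m _; rewrite mxE.
Qed.

End ProductSquares.

Lemma has_nontrivial_relation_product k (T : finType)
    (p q : 'I_k -> T -> bool) (f g : T -> bool) :
    (forall m, balanced (p m)) -> (forall m, balanced (q m)) ->
    (forall m m' : 'I_k, m < m' ->
       balanced (fun x => p m x (+) p m' x) ||
       balanced (fun x => q m x (+) q m' x)) ->
    (forall x, \xor_m p m x = f x) -> (forall x, \xor_m q m x = g x) ->
  has_nontrivial_relation k #|T| #|f| #|g|.
Proof.
move=> p_bal q_bal pq_bal p_sum q_sum; have enum_bij := @enum_val_bij T.
rewrite -(eq_card p_sum) -(eq_card q_sum).
rewrite -(card_comp_bij (fun x => \xor_m p m x) enum_bij).
rewrite -(card_comp_bij (fun x => \xor_m q m x) enum_bij).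
apply: (@product_squares_relation k _ (fun m => p m \o enum_val)
  (fun m => q m \o enum_val)) => [m|m|m m' /pq_bal].
- by rewrite balanced_comp_bij.
- by rewrite balanced_comp_bij.
- by rewrite -!(balanced_comp_bij _ enum_bij).
Qed.

Section BitPatterns.
Variable T : finType.
Implicit Types f g : T -> bool.

Lemma balanced_fst_addb f : balanced (fun x : bool * T => x.1 (+) f x.2).
Proof.
by rewrite (balanced_addb_pair id f) -sign_sum_eq0 /sign_sum big_bool.
Qed.

Lemma balanced_fst : balanced (fun x : bool * T => x.1).
Proof.
rewrite (eq_balanced (g := fun x => x.1 (+) false)) => [|x].
  exact: (balanced_fst_addb xpred0).
by rewrite addbF.
Qed.

Lemma balanced_snd f : balanced f -> balanced (fun x : bool * T => f x.2).
Proof. by move=> f_bal; rewrite (balanced_addb_pair xpred0 f) f_bal orbT. Qed.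

Lemma card_snd f : #|fun x : bool * T => f x.2| = 2 * #|f|.
Proof. by rewrite -card_bool -cardX; apply: eq_card => x; rewrite !inE. Qed.

Lemma card_bool_prod : #|{: bool * T}| = 2 * #|T|.
Proof. by rewrite card_prod card_bool. Qed.

Lemma has_nontrivial_relation1 : has_nontrivial_relation 1 (2 * #|T|) #|T| #|T|.
Proof.
have card_fst : #|fun x : bool * T => x.1| = #|T|.
  apply/eqP; rewrite -(eqn_pmul2l (ltn0Sn 1)) -card_bool_prod.
  exact: balanced_fst.
rewrite -{2 3}card_fst -card_bool_prod.
apply: (@has_nontrivial_relation_product 1 _ (fun _ => fst) (fun _ => fst)).
- by move=> _; exact: balanced_fst.
- by move=> _; exact: balanced_fst.
- by move=> m m'; rewrite !ord1.
- by move=> x; rewrite big_ord1.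
- by move=> x; rewrite big_ord1.
Qed.

Definition bit_pattern2 f (m : 'I_2) (x : bool * T) : bool :=
  x.1 (+) ((m == ord_max) && f x.2).

Lemma bit_pattern2_balanced f m : balanced (bit_pattern2 f m).
Proof. exact: (balanced_fst_addb (fun t => (m == ord_max) && f t)). Qed.

Lemma bit_pattern2_xor f x : \xor_m bit_pattern2 f m x = f x.2.
Proof. by rewrite big_ord_recl big_ord1 /bit_pattern2 addbF addKb. Qed.

Lemma has_nontrivial_relation2 f f' : balanced f || balanced f' ->
  has_nontrivial_relation 2 (2 * #|T|) (2 * #|f|) (2 * #|f'|).
Proof.
move=> ff'_bal; rewrite -(card_snd f) -(card_snd f') -card_bool_prod.
apply: (has_nontrivial_relation_product (p := bit_pattern2 f)
  (q := bit_pattern2 f')) => [m|m|m m' m_lt_m'|x|x].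
- exact: bit_pattern2_balanced.
- exact: bit_pattern2_balanced.
- have pair_xor h x : bit_pattern2 h m x (+) bit_pattern2 h m' x = h x.2.
    rewrite -bit_pattern2_xor big_ord_recl big_ord1.
    by case: m m' m_lt_m' => [[|[|//]] ?] [[|[|//]] ?].
  rewrite !(eq_balanced (pair_xor _)).
  by case/orP: ff'_bal => /balanced_snd ->; rewrite ?orbT.
- exact: bit_pattern2_xor.
- exact: bit_pattern2_xor.
Qed.

Definition bit_pattern3 g f (m : 'I_3) (x : bool * T) : bool :=
  nth false [:: x.1 (+) (g x.2 (+) f x.2); x.1; g x.2] m.

Lemma bit_pattern3_balanced g f m : balanced g -> balanced (bit_pattern3 g f m).
Proof.
move=> g_bal; case: m => [[|[|[|//]]] ?].
- exact: (balanced_fst_addb (fun t => g t (+) f t)).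
- exact: balanced_fst.
- exact: balanced_snd.
Qed.

Lemma bit_pattern3_xor g f x : \xor_m bit_pattern3 g f m x = f x.2.
Proof.
rewrite !big_ord_recl big_ord0 /bit_pattern3 /=.
by case: x.1 (g _) (f _) => [] [] [].
Qed.

(* Patterns 0 and 1 sum to g + f, which need not be balanced: reversing the
   order of the patterns on the columns moves this defect to the squares 1 and
   2, for which the sum of the row patterns is balanced. *)
Lemma has_nontrivial_relation3 g f f' : balanced g ->
  has_nontrivial_relation 3 (2 * #|T|) (2 * #|f|) (2 * #|f'|).
Proof.
move=> g_bal; rewrite -(card_snd f) -(card_snd f') -card_bool_prod.
apply: (has_nontrivial_relation_product (p := bit_pattern3 g f)
  (q := fun m => bit_pattern3 g f' (rev_ord m))) => [m|m||x|x].
- exact: bit_pattern3_balanced.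
- exact: bit_pattern3_balanced.
- move=> [[|[|[|//]]] ?] [[|[|[|//]]] ?] //= _; apply/orP.
  + right; rewrite (eq_balanced (g := fun x => x.1 (+) g x.2)) => [|x].
      exact: balanced_fst_addb.
    by rewrite addbC.
  + left; rewrite (eq_balanced (g := fun x => x.1 (+) f x.2)) => [|x].
      exact: balanced_fst_addb.
    by rewrite /bit_pattern3 /= -addbA [_ (+) f _]addbC addbK.
  + by left; exact: balanced_fst_addb.
- exact: bit_pattern3_xor.
- by rewrite -(bit_pattern3_xor g) [RHS](reindex_inj rev_ord_inj).
Qed.

End BitPatterns.

Lemma card_ord_lt n c : c <= n -> #|fun i : 'I_n => i < c| = c.
Proof.
by move=> c_le_n; rewrite -sum1_card (big_ord_narrow c_le_n) sum1_card card_ord.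
Qed.

Lemma balanced_ord_lt n c : n = 2 * c -> balanced (fun i : 'I_n => i < c).
Proof. by move=> nE; rewrite /balanced card_ord_lt ?card_ord nE //; lia. Qed.

Lemma has_nontrivial_relation_odd k l a b : 0 < l ->
  has_nontrivial_relation k (2 * l) a b ->
  odd a = odd (k * l) /\ odd b = odd (k * l).
Proof.
move=> l_gt0.
have : [/\ 0 < 2 * l, ~~ odd (2 * l) & (2 * l)./2 = l].
  by rewrite muln_gt0 mul2n odd_double doubleK.
move: (2 * l) => n [n_gt0 n_even <-] /has_nontrivial_relation_xor_splits.
move=> [F [e [A [B [[F_freq _] split_F <- <-]]]]].
split; last exact: xor_splits_odd_card split_F.
apply: xor_splits_odd_card (xor_splits_tr split_F) => // m.
exact: freq_square_tr.
Qed.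

Lemma has_nontrivial_relation1P l a b : 0 < l ->
  has_nontrivial_relation 1 (2 * l) a b <-> a = l /\ b = l.
Proof.
move=> l_gt0; have n_gt0 : 0 < 2 * l by rewrite muln_gt0.
split=> [/has_nontrivial_relation_xor_splits|[-> ->]].
  move=> [F [e [A [B [[F_freq _] split_F <- <-]]]]].
  have card_B := xor_splits1_card n_gt0 (F_freq ord0) split_F.
  have card_A := xor_splits1_card n_gt0 (freq_square_tr (F_freq ord0))
    (xor_splits_tr split_F).
  by split; lia.
by have := has_nontrivial_relation1 'I_l; rewrite card_ord.
Qed.

Lemma has_nontrivial_relation2P l a b :
    0 < l -> a <= 2 * l -> b <= 2 * l ->
  has_nontrivial_relation 2 (2 * l) a b <->
  [/\ ~~ odd l, ~~ odd a & ~~ odd b] /\ (a = l \/ b = l).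
Proof.
move=> l_gt0 a_le b_le; split=> [rel|[[l_even a_even b_even] half]].
  have [odd_a odd_b] := has_nontrivial_relation_odd l_gt0 rel.
  have [F [e [A [B [F_MOFS split_F card_A card_B]]]]] :=
    has_nontrivial_relation_xor_splits rel.
  have half := xor_splits2_card F_MOFS split_F.
  by split; first split; lia.
have := @has_nontrivial_relation2 'I_l (fun i => i < a./2) (fun i => i < b./2).
rewrite card_ord !card_ord_lt; try lia.
rewrite !mul2n !even_halfK // -mul2n; apply.
by apply/orP; case: half => half; [left | right]; apply: balanced_ord_lt; lia.
Qed.

Lemma has_nontrivial_relation3P l a b :
    0 < l -> a <= 2 * l -> b <= 2 * l ->
  has_nontrivial_relation 3 (2 * l) a b <-> [/\ ~~ odd l, ~~ odd a & ~~ odd b].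
Proof.
move=> l_gt0 a_le b_le; split=> [rel|[l_even a_even b_even]].
  have [odd_a odd_b] := has_nontrivial_relation_odd l_gt0 rel.
  have [F [e [A [B [F_MOFS split_F card_A card_B]]]]] :=
    has_nontrivial_relation_xor_splits rel.
  rewrite odd_a odd_b oddM; suff -> : ~~ odd l by [].
  by apply: (xor_splits3_even F_MOFS split_F); rewrite ?card_A ?card_B; lia.
have := @has_nontrivial_relation3 'I_l (fun i => i < l./2)
  (fun i => i < a./2) (fun i => i < b./2).
rewrite card_ord !card_ord_lt; try lia.
rewrite !mul2n !even_halfK // -mul2n; apply.
by apply: balanced_ord_lt; lia.
Qed.

Theorem theorem2p7 (lambda a b : nat) (lambda_gt0 : 0 < lambda)
    (a_le : a <= 2 * lambda) (b_le : b <= 2 * lambda) :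
  [/\ (exists (F : 'I_1 -> 'M[bool]_(2 * lambda)) (X : col_subsets (2 * lambda) 1),
         is_MOFS F /\
         [/\ is_relation F X, square_nontrivial X,
             #|X (first_col 1)| = a & #|X (second_col 1)| = b])
      <-> (a = lambda /\ b = lambda),
      (exists (F : 'I_2 -> 'M[bool]_(2 * lambda)) (X : col_subsets (2 * lambda) 2),
         is_MOFS F /\
         [/\ is_relation F X, square_nontrivial X,
             #|X (first_col 2)| = a & #|X (second_col 2)| = b])
      <-> ([/\ ~~ odd lambda, ~~ odd a & ~~ odd b] /\ (a = lambda \/ b = lambda))
    & (exists (F : 'I_3 -> 'M[bool]_(2 * lambda)) (X : col_subsets (2 * lambda) 3),
         is_MOFS F /\
         [/\ is_relation F X, square_nontrivial X,
             #|X (first_col 3)| = a & #|X (second_col 3)| = b])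
      <-> [/\ ~~ odd lambda, ~~ odd a & ~~ odd b]].
Proof.
split.
- exact: has_nontrivial_relation1P.
- exact: has_nontrivial_relation2P.
- exact: has_nontrivial_relation3P.
Qed.
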